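(* Let $\mathcal{P}$ be a PTRS that is orthogonal and spare. Then $\mathrm{erc}_{\xrightarrow{\mathbf{f}}_{\mathcal{P}}}=\mathrm{erc}_{\xrightarrow{\mathbf{i}}_{\mathcal{P}}}$.
   Context: Terms $\mathcal{T}$ over countable signature and variables. $\mathrm{FDist}(A)$: finite multisets of pairs $(p:a)$, $0<p\le1$, probabilities summing to 1. A PTRS: countable set $\mathcal{P}$ of rules $\ell\to\mu$, $\ell$ non-variable, $\mu\in\mathrm{FDist}(\mathcal{T})$, $\mathcal{V}(r)\subseteq\mathcal{V}(\ell)$ for $r\in\mathrm{Supp}(\mu)$. $s\xrightarrow{\mathbf{f}}_{\mathcal{P}}\{p_1:t_1,\dots,p_k:t_k\}$ iff $s|_\pi=\ell\sigma$, $t_j=s[r_j\sigma]_\pi$ for position $\pi$, rule $\ell\to\{p_1:r_1,\dots,p_k:r_k\}$, substitution $\sigma$; innermost ($\xrightarrow{\mathbf{i}}_{\mathcal{P}}$) if all proper subterms of $\ell\sigma$ are normal forms. Basic terms: $f(t_1,\dots,t_k)$ where $f$ is the root of some left-hand side and no $t_i$ contains such a symbol. Lifting $\rightrightarrows$ of $\to$: smallest relation on $\mathrm{FDist}(\mathcal{T})$ with $\{1:t\}\rightrightarrows\{1:t\}$ for normal forms, $\{1:t\}\rightrightarrows\mu$ if $t\to\mu$, closed under convex combinations $\bigcup_jp_j\cdot\mu_j\rightrightarrows\bigcup_jp_j\cdot\nu_j$. $|\mu|_\to$: probability of normal forms; $\mathrm{edl}((\mu_n))=\sum_n(1-|\mu_n|_\to)$;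 $\mathrm{edh}_\to(t)=\sup$ of $\mathrm{edl}$ over infinite $\rightrightarrows$-sequences from $\{1:t\}$. Size $|x|=1$, $|f(t_1..t_k)|=1+\sum|t_i|$; $\mathrm{erc}_\to(n)=\sup\{\mathrm{edh}_\to(t)\mid t$ basic, $|t|\le n\}$. Orthogonal: left-linear and non-overlapping (no two rules, renamed apart, and non-variable position $\pi$ of the first left-hand side whose subterm unifies with the second left-hand side, $\pi\ne\varepsilon$ for the same rule). Spare: a $\xrightarrow{\mathbf{f}}_{\mathcal{P}}$-step with rule $\ell\to\mu$ and substitution $\sigma$ is spare if $\sigma(x)$ is a normal form for every variable $x$ occurring more than once in some $r\in\mathrm{Supp}(\mu)$; $\mathcal{P}$ is spare if every $\rightrightarrows$-sequence (lifting of $\xrightarrow{\mathbf{f}}_{\mathcal{P}}$) starting with $\{1:t\}$ for basic $t$ uses only spare steps. *)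

(* Defs.v *)
From HB Require Import structures.
From mathcomp Require Import all_boot all_order all_algebra.
From mathcomp Require Import finmap multiset.
From mathcomp Require Import all_classical all_reals all_analysis.

Set Implicit Arguments.
Unset Strict Implicit.
Unset Printing Implicit Defensive.

Import Order.TTheory GRing.Theory Num.Theory.

Local Open Scope classical_set_scope.
Local Open Scope mset_scope.
Local Open Scope ring_scope.

Section FDist.
Context {R : realType} {T : choiceType}.

Definition is_fdist (m : {mset (R * T)}) : bool :=
  all (fun x => 0 < x.1 <= 1) m && (\sum_(x <- m) x.1 == 1).

Record fdist : Type := FDist { fdval :> {mset (R * T)}; fdvalP : is_fdist fdval }.

Definition supp (mu : fdist) : set T := [set a | exists p, (p, a) \in fdval mu].

Lemma dirac_subproof (t : T) : is_fdist [mset (1 : R, t)].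
Proof.
by rewrite /is_fdist (enum_msetn 1) /= big_seq1 /= ltr01 lexx eqxx.
Qed.

Definition fdirac (t : T) : fdist := FDist (dirac_subproof t).

Definition weights k (p : 'I_k -> R) : bool :=
  [forall j, 0 < p j] && (\sum_(j < k) p j == 1).

Definition convex_mset k (p : 'I_k -> R) (mu : 'I_k -> fdist) : {mset (R * T)} :=
  seq_mset
    (flatten [seq [seq (p j * x.1, x.2) | x <- fdval (mu j)] | j <- enum 'I_k]).

Lemma convex_subproof k (p : 'I_k -> R) (hp : weights p) (mu : 'I_k -> fdist) :
  is_fdist (convex_mset p mu).
Proof.
have /andP[/forallP p0 /eqP p1] := hp.
have ple1 j : p j <= 1.
  by rewrite -p1 (bigD1 j) //= lerDl sumr_ge0// => i _; apply: ltW.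
apply/andP; split.
  apply/allP => x; rewrite (perm_mem (perm_eq_seq_mset _)).
  move=> /flattenP[_ /mapP[j _ ->] /mapP[y yin ->]] /=.
  have /andP[/allP /(_ y yin)/andP[y0 y1] _] := fdvalP (mu j).
  by rewrite mulr_gt0//= mulr_ile1// ltW.
rewrite (perm_big _ (perm_eq_seq_mset _))/= big_flatten/= big_map big_enum/=.
rewrite -[eqbRHS]p1; apply/eqP; apply: eq_bigr => j _.
rewrite big_map/= -mulr_sumr.
by have /andP[_ /eqP ->] := fdvalP (mu j); rewrite mulr1.
Qed.

Definition convex_comb k (p : 'I_k -> R) (hp : weights p) (mu : 'I_k -> fdist) : fdist :=
  FDist (convex_subproof hp mu).

End FDist.
Arguments fdist : clear implicits.

Section FDistMap.
Context {R : realType} {T U : choiceType}.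

Lemma fdmap_subproof (f : T -> U) (mu : fdist R T) :
  is_fdist (seq_mset [seq (x.1, f x.2) | x <- fdval mu]).
Proof.
have /andP[/allP mu0 mu1] := fdvalP mu.
apply/andP; split.
  apply/allP => x; rewrite (perm_mem (perm_eq_seq_mset _)).
  by move=> /mapP[y /mu0 ? ->].
by rewrite (perm_big _ (perm_eq_seq_mset _))/= big_map.
Qed.

Definition fdmap (f : T -> U) (mu : fdist R T) : fdist R U :=
  FDist (fdmap_subproof f mu).

End FDistMap.

Section Lifting.
Context {R : realType} {T : choiceType}.
Variable step : T -> fdist R T -> Prop.

Definition normal_form (t : T) : Prop := ~ exists mu, step t mu.

Inductive lifting : fdist R T -> fdist R T -> Prop :=
| lifting_nf t : normal_form t -> lifting (fdirac t) (fdirac t)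
| lifting_step t mu : step t mu -> lifting (fdirac t) mu
| lifting_convex k (p : 'I_k -> R) (hp : weights p) (mu nu : 'I_k -> fdist R T) :
    (forall j, lifting (mu j) (nu j)) ->
    lifting (convex_comb hp mu) (convex_comb hp nu).

Definition nf_prob (mu : fdist R T) : R :=
  \sum_(x <- fdval mu | `[< normal_form x.2 >]) x.1.

Definition edl (mu : nat -> fdist R T) : \bar R :=
  (\sum_(0 <= n <oo) (1 - nf_prob (mu n))%:E)%E.

Definition edh (t : T) : \bar R :=
  ereal_sup [set edl mu | mu in
    [set mu : nat -> fdist R T |
      mu 0%N = fdirac t /\ forall n, lifting (mu n) (mu n.+1)]].

End Lifting.

(* A lifting derivation together with the set of (labels of) the steps that it
   uses; the label l of a step s -> mu records how the step was performed. *)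
Section LiftingUses.
Context {R : realType} {T : choiceType} {L : Type}.
Variable step : L -> T -> fdist R T -> Prop.

Let some_step s mu := exists l, step l s mu.

Inductive lifting_uses : set L -> fdist R T -> fdist R T -> Prop :=
| lifting_uses_nf t :
    normal_form some_step t -> lifting_uses set0 (fdirac t) (fdirac t)
| lifting_uses_step l t mu :
    step l t mu -> lifting_uses [set l] (fdirac t) mu
| lifting_uses_convex k (p : 'I_k -> R) (hp : weights p)
    (mu nu : 'I_k -> fdist R T) (U : 'I_k -> set L) :
    (forall j, lifting_uses (U j) (mu j) (nu j)) ->
    lifting_uses (\bigcup_j U j) (convex_comb hp mu) (convex_comb hp nu).

Lemma liftingE mu nu :
  lifting some_step mu nu <-> exists U, lifting_uses U mu nu.
Proof.
split=> [|[U]].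
  elim=> {mu nu} [t nft|t mu [l st]|k p hp mu nu _ /choice[U HU]].
  - by exists set0; constructor.
  - by exists [set l]; constructor.
  - by exists (\bigcup_j U j); constructor.
elim=> {U mu nu} [t nft|l t mu st|k p hp mu nu U _ H].
- exact: lifting_nf.
- by apply: lifting_step; exists l.
- exact: lifting_convex.
Qed.

End LiftingUses.

(* The variables are the natural numbers. *)
Inductive term (F : countType) (ar : F -> nat) : Type :=
| Var of nat
| App (f : F) of ('I_(ar f) -> term ar).
Arguments Var {F ar}.
Arguments App {F ar}.

HB.instance Definition _ (F : countType) (ar : F -> nat) := gen_eqMixin (term ar).
HB.instance Definition _ (F : countType) (ar : F -> nat) := gen_choiceMixin (term ar).

Section Terms.
Context {F : countType} {ar : F -> nat}.
Local Notation term := (term ar).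

Fixpoint term_size (t : term) : nat :=
  match t with
  | Var _ => 1%N
  | App f ts => (\sum_(i < ar f) term_size (ts i))%N.+1
  end.

(* with repetitions, so that count_mem x (vars t) is the number of
   occurrences of x in t *)
Fixpoint vars (t : term) : seq nat :=
  match t with
  | Var x => [:: x]
  | App f ts => flatten [seq vars (ts i) | i <- enum 'I_(ar f)]
  end.

Fixpoint symbols (t : term) : seq F :=
  match t with
  | Var _ => [::]
  | App f ts => f :: flatten [seq symbols (ts i) | i <- enum 'I_(ar f)]
  end.

Definition is_var (t : term) : bool := if t is Var _ then true else false.

Definition root_symbol (t : term) : option F := if t is App f _ then Some f else None.

Fixpoint tsubst (sigma : nat -> term) (t : term) : term :=
  match t with
  | Var x => sigma x
  | App f ts => App f (fun i => tsubst sigma (ts i))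
  end.

(* Positions are sequences of argument indices, counted from 0;
   subterm_at t pi is None when pi is not a position of t. *)
Fixpoint subterm_at (t : term) (pi : seq nat) : option term :=
  match pi with
  | [::] => Some t
  | i :: pi' =>
      match t with
      | Var _ => None
      | App f ts =>
          if (insub i : option 'I_(ar f)) is Some j then subterm_at (ts j) pi'
          else None
      end
  end.

(* t[r]_pi; t is left unchanged when pi is not a position of t *)
Fixpoint replace_at (t : term) (pi : seq nat) (r : term) : term :=
  match pi with
  | [::] => r
  | i :: pi' =>
      match t with
      | Var x => Var x
      | App f ts =>
          App f (fun j => if nat_of_ord j == i then replace_at (ts j) pi' r
                          else ts j)
      end
  end.

Definition proper_subterm (u t : term) : Prop :=
  exists2 pi, pi != [::] & subterm_at t pi = Some u.

End Terms.

Section PTRS.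
Context {R : realType} {F : countType} {ar : F -> nat}.
Local Notation term := (term ar).

Definition rule : Type := (term * fdist R term)%type.

Implicit Types P : set rule.

Definition is_ptrs P : Prop :=
  countable P /\
  forall r, P r ->
    ~~ is_var r.1 /\
    forall u, supp r.2 u -> {subset vars u <= vars r.1}.

(* How a step is performed: position, rule, substitution. *)
Definition label : Type := (seq nat * rule * (nat -> term))%type.

Definition step_by P (l : label) (s : term) (nu : fdist R term) : Prop :=
  let: (pi, r, sigma) := l in
  [/\ P r,
      subterm_at s pi = Some (tsubst sigma r.1) &
      nu = fdmap (fun u => replace_at s pi (tsubst sigma u)) r.2].

Definition full_step P (s : term) (nu : fdist R term) : Prop :=
  exists l, step_by P l s nu.

Definition innermost_label P (l : label) : Prop :=
  let: (_, r, sigma) := l in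
  forall u, proper_subterm u (tsubst sigma r.1) -> normal_form (full_step P) u.

Definition innermost_step P (s : term) (nu : fdist R term) : Prop :=
  exists2 l, innermost_label P l & step_by P l s nu.

Definition defined_symbol P (f : F) : Prop :=
  exists2 r, P r & root_symbol r.1 = Some f.

Definition basic P (t : term) : Prop :=
  match t with
  | Var _ => False
  | App f ts =>
      defined_symbol P f /\
      forall i g, g \in symbols (ts i) -> ~ defined_symbol P g
  end.

(* The supremum of the empty set is -oo here. It is reached when there is no
   basic term of size at most n, a condition on P that does not involve step. *)
Definition erc P (step : term -> fdist R term -> Prop) (n : nat) : \bar R :=
  ereal_sup [set edh step t | t in [set t | basic P t /\ (term_size t <= n)%N]].

Definition left_linear P : Prop := forall r, P r -> uniq (vars r.1).

Definition unifiable (s t : term) : Prop :=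
  exists sigma, tsubst sigma s = tsubst sigma t.

Definition rename (rho : nat -> nat) (t : term) : term :=
  tsubst (fun x => Var (rho x)) t.

Definition overlap (r1 r2 : rule) (pi : seq nat) : Prop :=
  exists (rho : nat -> nat) (u : term),
    [/\ bijective rho,
        forall x, x \in vars r1.1 -> x \notin vars (rename rho r2.1),
        subterm_at r1.1 pi = Some u,
        ~~ is_var u &
        unifiable u (rename rho r2.1)].

Definition non_overlapping P : Prop :=
  forall r1 r2 pi, P r1 -> P r2 -> overlap r1 r2 pi -> r1 = r2 /\ pi = [::].

Definition orthogonal_ptrs P : Prop := left_linear P /\ non_overlapping P.

Definition spare_label P (l : label) : Prop :=
  let: (_, r, sigma) := l in
  forall x, (exists2 u, supp r.2 u & (1 < count_mem x (vars u))%N) ->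
    normal_form (full_step P) (sigma x).

(* Quantifying over finite sequences mu_0, ..., mu_N also covers the infinite
   ones, whose steps all occur in a finite prefix. *)
Definition spare P : Prop :=
  forall (t : term) (N : nat) (mu : nat -> fdist R term) (U : nat -> set label),
    basic P t ->
    mu 0%N = fdirac t ->
    (forall n, (n < N)%N -> lifting_uses (step_by P) (U n) (mu n) (mu n.+1)) ->
    forall n, (n < N)%N -> (U n `<=` spare_label P)%classic.

End PTRS.
Arguments rule : clear implicits.

(* Main.v *)
(* Let [value n t] be the supremal expected number of full rewrite steps from
   [t] among the first [n] ones.  If [t] is reachable from a basic term and [p]
   is an innermost redex of [t], then every other redex of [t] commutes with it:
   by orthogonality and spareness, contracting the other redex leaves at most one
   copy of the redex at [p].  Induction on [n] gives
   [value n t <= 1 + E (value n t')], where [t'] is the random result of the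
   innermost step.  Unrolling this [K] times along any innermost strategy
   [mu] yields [value n t <= \sum_(k < K) a_k + n * a_K], where [a_k] is the
   probability that [mu k] is not a normal form, because [value n] is at most [n]
   and vanishes on normal forms.  Either [\sum_k a_k] diverges or [a_K] tends to
   [0]; in both cases [value n t] is at most the expected length of [mu]. *)
Require Import Defs.
From mathcomp Require Import all_boot all_order all_algebra.
From mathcomp Require Import finmap multiset.
From mathcomp Require Import all_classical all_reals all_analysis.

Set Implicit Arguments.
Unset Strict Implicit.
Unset Printing Implicit Defensive.

Import Order.TTheory GRing.Theory Num.Theory.

Local Open Scope classical_set_scope.
Local Open Scope ring_scope.

(** * Positions, replacement and substitution in terms *)

Section TermPositions.
Context {F : countType} {ar : F -> nat}.
Local Notation term := (term ar).
Implicit Types (t s u w : term) (p q : seq nat) (sigma : nat -> term).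

Lemma subterm_at_nil t : subterm_at t [::] = Some t.
Proof. by case: t. Qed.

Lemma replace_at_nil t w : replace_at t [::] w = w.
Proof. by case: t. Qed.

Lemma subterm_at_ord f (ts : 'I_(ar f) -> term) (j : 'I_(ar f)) p :
  subterm_at (App f ts) (nat_of_ord j :: p) = subterm_at (ts j) p.
Proof. by rewrite /= valK. Qed.

Lemma subterm_at_consP t i p s : subterm_at t (i :: p) = Some s ->
  exists f (ts : 'I_(ar f) -> term) (j : 'I_(ar f)),
    [/\ t = App f ts, i = j & subterm_at (ts j) p = Some s].
Proof.
case: t => [x|f ts] //=; case: insubP => // j _ <- st.
by exists f, ts, j.
Qed.

(** The type of the arguments of [App] depends on [f]; reading off each argument with [subterm_at]
    avoids an equality of dependent pairs. *)
Lemma App_inj f (ts ts' : 'I_(ar f) -> term) : App f ts = App f ts' -> ts = ts'.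
Proof.
move=> e; apply/funext => j.
have := congr1 (subterm_at^~ [:: nat_of_ord j]) e.
by rewrite !subterm_at_ord !subterm_at_nil => -[].
Qed.

Lemma subterm_at_cat t p q :
  subterm_at t (p ++ q) = obind (fun s => subterm_at s q) (subterm_at t p).
Proof.
elim: p t => [|i p IH] [x|f ts] //=.
by case: insubP => // j _ _; exact: IH.
Qed.

Lemma subterm_replace_at t p s w q : subterm_at t p = Some s ->
  subterm_at (replace_at t p w) (p ++ q) = subterm_at w q.
Proof.
elim: p t => [|i p IH] t; first by rewrite replace_at_nil.
move=> /subterm_at_consP[f [ts [j [-> -> st]]]].
by rewrite cat_cons /= valK eqxx (IH _ st).
Qed.

Lemma subterm_replace_same t p s w : subterm_at t p = Some s ->
  subterm_at (replace_at t p w) p = Some w.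
Proof.
by move=> /(subterm_replace_at w [::]); rewrite cats0 subterm_at_nil.
Qed.

Lemma replace_at_cat t p s q w : subterm_at t p = Some s ->
  replace_at t (p ++ q) w = replace_at t p (replace_at s q w).
Proof.
elim: p t => [|i p IH] t; first by rewrite subterm_at_nil replace_at_nil => -[->].
move=> /subterm_at_consP[f [ts [j [-> -> st]]]] /=.
congr (App f _); apply/funext => i'; case: eqP => // /val_inj ->; exact: IH.
Qed.

Lemma replace_at_twice t p w w' :
  replace_at (replace_at t p w) p w' = replace_at t p w'.
Proof.
elim: p t => [|i p IH] t; first by rewrite !replace_at_nil.
case: t => [x|f ts] //=; congr (App f _); apply/funext => j.
by case: ifP => // ->.
Qed.

Definition parallel p q := ~~ prefix p q && ~~ prefix q p.

Lemma parallel_cons i j p q :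
  parallel (i :: p) (j :: q) = (i != j) || parallel p q.
Proof.
by rewrite /parallel !prefix_cons (eq_sym j i); case: eqP.
Qed.

Lemma subterm_replace_parallel t p q w : parallel p q ->
  subterm_at (replace_at t p w) q = subterm_at t q.
Proof.
elim: p q t => [|i p IH] [|j q] [x|f ts] //; try by rewrite /parallel/= ?andbF.
rewrite parallel_cons /=; case: insubP => // k _ <-.
by rewrite (eq_sym i); case: ifP => //= _; exact: IH.
Qed.

Lemma replace_at_parallel t p q w w' : parallel p q ->
  replace_at (replace_at t p w) q w' = replace_at (replace_at t q w') p w.
Proof.
elim: p q t => [|i p IH] [|j q] [x|f ts] //; try by rewrite /parallel/= ?andbF.
rewrite parallel_cons /= => pq; congr (App f _); apply/funext => k.
have [ki|//] := eqVneq (k : nat) i; have [kj|//] := eqVneq (k : nat) j.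
by apply: IH; move: pq; rewrite -ki -kj eqxx.
Qed.

Lemma subterm_at_tsubst sigma u p s :
  subterm_at u p = Some s -> subterm_at (tsubst sigma u) p = Some (tsubst sigma s).
Proof.
elim: p u => [|i p IH] u; first by rewrite !subterm_at_nil => -[->].
move=> /subterm_at_consP[f [ts [j [-> -> st]]]].
by rewrite /= valK; exact: IH.
Qed.

(** This dichotomy drives the analysis of nested redexes: the first case yields an overlap, the
    second places the inner redex inside the substitution. *)
Lemma subterm_at_tsubstP sigma u p s : subterm_at (tsubst sigma u) p = Some s ->
  (exists2 v, subterm_at u p = Some v & ~~ is_var v /\ s = tsubst sigma v) \/
  (exists p1 p2 x, [/\ p = p1 ++ p2, subterm_at u p1 = Some (Var x) &
                       subterm_at (sigma x) p2 = Some s]).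
Proof.
elim: u p => [x|f ts IH] p.
  by move=> st; right; exists [::], p, x.
case: p => [[<-]|i p /= ]; first by left; exists (App f ts).
case: insubP => // j _ <- /IH[[v -> h]|[p1 [p2 [x [-> h1 h2]]]]].
  by left; exists v.
by right; exists (nat_of_ord j :: p1), p2, x; rewrite /= valK.
Qed.

Lemma mem_vars_arg f (ts : 'I_(ar f) -> term) x :
  (x \in vars (App f ts)) <-> exists j, x \in vars (ts j).
Proof.
split=> [/flattenP[_ /mapP[j _ ->] xj]|[j xj]]; first by exists j.
by apply/flattenP; exists (vars (ts j)) => //; apply/mapP; exists j; rewrite ?mem_enum.
Qed.

Lemma vars_subterm u p s : subterm_at u p = Some s -> {subset vars s <= vars u}.
Proof.
elim: p u => [|i p IH] u; first by rewrite !subterm_at_nil => -[->].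
move=> /subterm_at_consP[f [ts [j [-> _ st]]]] x /(IH _ st) xj.
by apply/mem_vars_arg; exists j.
Qed.

Lemma vars_position u x : x \in vars u -> exists p, subterm_at u p = Some (Var x).
Proof.
elim: u => [y|f ts IH]; first by rewrite inE => /eqP ->; exists [::].
move=> /mem_vars_arg[j /IH[p st]]; exists (nat_of_ord j :: p).
by rewrite subterm_at_ord.
Qed.

Lemma eq_tsubst sigma sigma' u :
  {in vars u, sigma =1 sigma'} -> tsubst sigma u = tsubst sigma' u.
Proof.
elim: u => [x|f ts IH] e /=; first by apply: e; rewrite inE.
congr (App f _); apply/funext => j; apply: IH => x xj; apply: e.
by apply/mem_vars_arg; exists j.
Qed.

Lemma tsubst_inj_vars sigma sigma' u :
  tsubst sigma u = tsubst sigma' u -> {in vars u, sigma =1 sigma'}.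
Proof.
elim: u => [x|f ts IH] /=; first by move=> e y; rewrite inE => /eqP ->.
move=> /App_inj e x /mem_vars_arg[j]; apply: IH.
exact: (congr1 (@^~ j) e).
Qed.

Lemma tsubst_comp sigma sigma' u :
  tsubst sigma (tsubst sigma' u) = tsubst (fun x => tsubst sigma (sigma' x)) u.
Proof. by elim: u => [//|f ts IH] /=; congr (App f _); apply/funext. Qed.

Definition upd sigma x w : nat -> term := fun y => if y == x then w else sigma y.

Lemma tsubst_upd_notin sigma x w u :
  x \notin vars u -> tsubst (upd sigma x w) u = tsubst sigma u.
Proof.
move=> xu; apply: eq_tsubst => y yu; rewrite /upd; case: eqP => // yx.
by rewrite -yx yu in xu.
Qed.

Lemma count_vars_App f (ts : 'I_(ar f) -> term) x :
  count_mem x (vars (App f ts)) = (\sum_j count_mem x (vars (ts j)))%N.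
Proof.
by rewrite /= count_flatten sumnE !big_map; apply: eq_bigr.
Qed.

Lemma tsubst_upd_linear sigma x w u p :
  subterm_at u p = Some (Var x) -> (count_mem x (vars u) <= 1)%N ->
  tsubst (upd sigma x w) u = replace_at (tsubst sigma u) p w.
Proof.
elim: p u => [|i p IH] u.
  by rewrite subterm_at_nil replace_at_nil => -[-> _]; rewrite /= /upd eqxx.
move=> /subterm_at_consP[f [ts [j [-> -> st]]]].
rewrite count_vars_App (bigD1 j) //= => c1.
have xj : (0 < count_mem x (vars (ts j)))%N.
  by rewrite -has_count has_pred1; apply: (vars_subterm st); rewrite inE.
congr (App f _); apply/funext => k; case: eqP => [/val_inj ->|/eqP kj].
  by apply: IH => //; apply: leq_trans c1; rewrite leq_addr.
(* Argument [j] already contains the only occurrence of [x], so argument [k] contains none and is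
   unaffected by the update. *)
apply: tsubst_upd_notin; rewrite -has_pred1 has_count -leqNgt leqn0.
move: c1; rewrite (bigD1 k) //= addnA => /(leq_trans (leq_addr _ _)).
case: (count_mem x (vars (ts j))) xj => // c _.
by rewrite addSn ltnS leqn0 addn_eq0 => /andP[].
Qed.

End TermPositions.

(** * Redexes, overlaps and commutation of steps *)

Lemma renaming_apart (xs ys : seq nat) : exists2 rho : nat -> nat,
  involutive rho & forall x y, x \in xs -> y \in ys -> rho y != x.
Proof.
pose N := (\max_(x <- xs ++ ys) x).+1.
have ltN x : x \in xs ++ ys -> (x < N)%N by move=> xs_x; rewrite ltnS leq_bigmax_seq.
(* With [N] above all listed variables, [rho] swaps the blocks [0, N) and [N, 2N) and fixes the
   rest. *)
pose rho x := if (x < N)%N then (x + N)%N else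
              if (x < N + N)%N then (x - N)%N else x.
exists rho => [x|x y xin yin].
  rewrite {2}/rho; case: (ltnP x N) => xN.
    by rewrite /rho ltnNge leq_addl /= ltn_add2r xN addnK.
  case: (ltnP x (N + N)) => xNN; last by rewrite /rho ltnNge xN/= ltnNge xNN.
  by rewrite /rho ltn_subLR// xNN subnK.
have yN : (y < N)%N by apply: ltN; rewrite mem_cat yin orbT.
have xN : (x < N)%N by apply: ltN; rewrite mem_cat xin.
rewrite /rho yN; apply: contraTneq xN => <-.
by rewrite -leqNgt leq_addl.
Qed.

Section Rewriting.
Context {R : realType} {F : countType} {ar : F -> nat}.
Local Notation term := (term ar).
Variable P : set (rule R F ar).
Implicit Types (t s u w : term) (p q : seq nat) (sigma : nat -> term).
Implicit Types r : rule R F ar.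

(** Once the variables of [r2] are renamed apart, [sigma1] and [sigma2] merge into a single
    unifier. *)
Lemma redex_overlap r1 r2 p u sigma1 sigma2 :
  subterm_at r1.1 p = Some u -> ~~ is_var u ->
  tsubst sigma1 u = tsubst sigma2 r2.1 -> overlap r1 r2 p.
Proof.
move=> up uN e.
have [rho rhoK rho_apart] := renaming_apart (vars r1.1) (vars r2.1).
have apart x : x \in vars (rename rho r2.1) -> exists2 y, y \in vars r2.1 & x = rho y.
  rewrite /rename; elim: (r2.1) => [y|f ts IH].
    by rewrite inE => /eqP ->; exists y; rewrite ?inE.
  move=> /mem_vars_arg[j /IH[y yj ->]]; exists y => //.
  by apply/mem_vars_arg; exists j.
exists rho, u; split => //.
- by exists rho.
- move=> x xin; apply/negP => /apart[y yin xy].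
  by have := rho_apart _ _ xin yin; rewrite xy eqxx.
exists (fun x => if x \in vars r1.1 then sigma1 x else sigma2 (rho x)).
rewrite /rename tsubst_comp; transitivity (tsubst sigma1 u).
  by apply: eq_tsubst => x /(vars_subterm up) ->.
rewrite e; apply: eq_tsubst => y yin /=.
rewrite rhoK ifN//; apply/negP => rin.
by have := rho_apart _ _ rin yin; rewrite eqxx.
Qed.

(** Two rules matching the same term overlap at the root, hence coincide. The match fixes the
    substitution on the variables of the left-hand side, which include those of the right-hand
    sides. *)
Lemma redex_unique r1 r2 sigma1 sigma2 : is_ptrs P -> orthogonal_ptrs P ->
  P r1 -> P r2 -> tsubst sigma1 r1.1 = tsubst sigma2 r2.1 ->
  r1 = r2 /\ forall u, supp r1.2 u -> tsubst sigma1 u = tsubst sigma2 u.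
Proof.
move=> [_ ptrs] [_ nov] P1 P2 e; have [nv1 sub1] := ptrs _ P1.
have [r12 _] := nov _ _ _ P1 P2 (redex_overlap (subterm_at_nil _) nv1 e).
split=> // u /sub1 usub; apply: eq_tsubst => x /usub xin.
by rewrite -r12 in e; apply: (tsubst_inj_vars e).
Qed.

Lemma normal_form_subterm t p s :
  subterm_at t p = Some s -> normal_form (full_step P) t ->
  normal_form (full_step P) s.
Proof.
move=> st nt [nu [[[q r] sigma] [Pr sq _]]]; apply: nt.
exists (fdmap (fun u => replace_at t (p ++ q) (tsubst sigma u)) r.2).
by exists (p ++ q, r, sigma); split=> //; rewrite subterm_at_cat st.
Qed.

Lemma redex_reducible p r sigma t : P r -> subterm_at t p = Some (tsubst sigma r.1) ->
  ~ normal_form (full_step P) t.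
Proof.
move=> Pr st; apply; exists (fdmap (fun u => replace_at t p (tsubst sigma u)) r.2).
by exists (p, r, sigma).
Qed.

(** Descend into a reducible argument as long as there is one; when all arguments are normal forms,
    the redex must be at the root and is innermost. *)
Lemma innermost_redex t : ~ normal_form (full_step P) t ->
  exists p r sigma, [/\ P r, subterm_at t p = Some (tsubst sigma r.1) &
                        innermost_label P (p, r, sigma)].
Proof.
elim: t => [x|f ts IH] /contrapT[nu [[[p r] sigma] [Pr st _]]].
  case: p st => // st; exists [::], r, sigma; split=> // u [[|i p] // _].
  by move: st; rewrite subterm_at_nil => -[<-].
have [[j nj]|nfs] := pselect (exists j, ~ normal_form (full_step P) (ts j)).
  have [q [r' [sigma' [Pr' sq inn]]]] := IH j nj.
  by exists (nat_of_ord j :: q), r', sigma'; split=> //; rewrite subterm_at_ord.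
have {}nfs j : normal_form (full_step P) (ts j).
  by apply: contrapT => nj; apply: nfs; exists j.
case: p st => [|i p] /=; last first.
  by case: insubP => // j _ _ /(redex_reducible Pr) /(_ (nfs j)).
move=> [e]; exists [::], r, sigma; split; rewrite /= -?e //.
move=> u [[|i q] // _] /=.
by case: insubP => // j _ _ /normal_form_subterm; apply.
Qed.

(** Consequently both relations assign the same [nf_prob] to every distribution. *)
Lemma normal_form_innermost :
  normal_form (innermost_step P) = normal_form (full_step P).
Proof.
apply/predeqP => t; split=> [nt|nt [nu [l _ st]]]; last by apply: nt; exists nu, l.
apply: contrapT => /innermost_redex[p [r [sigma [Pr st inn]]]]; apply: nt.
by exists (fdmap (fun u => replace_at t p (tsubst sigma u)) r.2), (p, r, sigma).
Qed.

(* Since [r2] contracts an innermost redex, contracting the [r1]-redex either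
   moves the [r2]-redex to one position, or erases it: spareness excludes
   duplication, and orthogonality keeps the [r1]-redex alive after the [r2]-step. *)
Lemma redex_commute t p1 r1 sigma1 p2 r2 sigma2 :
  orthogonal_ptrs P -> P r1 -> P r2 ->
  subterm_at t p1 = Some (tsubst sigma1 r1.1) -> spare_label P (p1, r1, sigma1) ->
  subterm_at t p2 = Some (tsubst sigma2 r2.1) ->
  innermost_label P (p2, r2, sigma2) -> p1 <> p2 ->
  exists sub : term -> nat -> term,
    (forall w, subterm_at (replace_at t p2 w) p1 = Some (tsubst (sub w) r1.1)) /\
    (forall u, supp r1.2 u ->
      let res w := replace_at (replace_at t p2 w) p1 (tsubst (sub w) u) in
      let s := replace_at t p1 (tsubst sigma1 u) in
      (exists2 q, subterm_at s q = Some (tsubst sigma2 r2.1) &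
         forall w, res w = replace_at s q w) \/ (forall w, res w = s)).
Proof.
move=> [ll nov] P1 P2 st1 spare1 st2 inn2 p12.
(* The [r1]-redex cannot lie strictly below the innermost [r2]-redex. *)
have [/prefixP[q pq]|np21] := boolP (prefix p2 p1).
  case: q pq => [|i q] pq; first by rewrite cats0 in pq.
  have sq : subterm_at (tsubst sigma2 r2.1) (i :: q) = Some (tsubst sigma1 r1.1).
    by move: st1; rewrite pq subterm_at_cat st2.
  have nf1 : normal_form (full_step P) (tsubst sigma1 r1.1).
    by apply: inn2; exists (i :: q).
  by case: (redex_reducible P1 (subterm_at_nil _) nf1).
(* At parallel positions the two steps do not interact, so [sigma1] is kept. The remaining case has
   the [r2]-redex strictly below the [r1]-redex. *)
have [/prefixP[q pq]|np12] := boolP (prefix p1 p2); last first.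
  have par : parallel p2 p1 by rewrite /parallel np21.
  have par' : parallel p1 p2 by rewrite /parallel np12.
  exists (fun=> sigma1); split=> [w|u _]; first by rewrite subterm_replace_parallel.
  left; exists p2; first by rewrite subterm_replace_parallel.
  by move=> w; exact: replace_at_parallel.
have q0 : q <> [::] by move=> q0; move: pq; rewrite q0 cats0 => /esym.
have sq : subterm_at (tsubst sigma1 r1.1) q = Some (tsubst sigma2 r2.1).
  by move: st2; rewrite pq subterm_at_cat st1.
(* Meeting the pattern of [r1] at a function symbol would be a forbidden overlap below the root, so
   the [r2]-redex sits in [sigma1 x] at [k2]. *)
case/subterm_at_tsubstP: (sq) => [[v vq [vN e]]|[k1 [k2 [x [qk lx sx]]]]].
  by case: (nov _ _ _ P1 P2 (redex_overlap vq vN (esym e))).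
(* By left-linearity [x] occurs once in [r1.1], so a replacement inside [sigma1 x] is again an
   instance of [r1.1]. *)
have tsub w : replace_at t p2 w =
    replace_at t p1 (tsubst (upd sigma1 x (replace_at (sigma1 x) k2 w)) r1.1).
  rewrite pq (replace_at_cat _ _ st1) qk.
  rewrite (replace_at_cat _ _ (subterm_at_tsubst sigma1 lx)).
  by rewrite -(tsubst_upd_linear _ _ lx)// count_uniq_mem ?leq_b1//; exact: ll.
exists (fun w => upd sigma1 x (replace_at (sigma1 x) k2 w)); split=> [w|u su].
  by rewrite tsub (subterm_replace_same _ st1).
move=> res s.
have resE w : res w =
    replace_at t p1 (tsubst (upd sigma1 x (replace_at (sigma1 x) k2 w)) u).
  by rewrite /res tsub replace_at_twice.
(* [sigma1 x] contains the [r2]-redex and is thus not a normal form; spareness then forbids two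
   occurrences of [x] in [u]. *)
have x1 : (count_mem x (vars u) <= 1)%N.
  rewrite leqNgt; apply/negP => x2.
  by apply: (redex_reducible P2 sx); apply: spare1; exists u.
(* If [x] does not occur in [u], the [r2]-redex is erased; otherwise it moves below the unique
   occurrence of [x]. *)
have [xu|xu] := boolP (x \in vars u); last first.
  by right=> w; rewrite resE tsubst_upd_notin.
have [k ku] := vars_position xu; left; exists (p1 ++ k ++ k2) => [|w].
  rewrite (subterm_replace_at _ _ st1) subterm_at_cat.
  by rewrite (subterm_at_tsubst sigma1 ku).
rewrite resE /s (tsubst_upd_linear _ _ ku)//.
have st : subterm_at s p1 = Some (tsubst sigma1 u).
  exact: (subterm_replace_same _ st1).
rewrite (replace_at_cat _ _ st) replace_at_twice.
by rewrite (replace_at_cat _ _ (subterm_at_tsubst sigma1 ku)).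
Qed.

End Rewriting.

(** * Expectations, supports and composition of finite distributions *)

Section Expectation.
Context {R : realType} {T : choiceType}.
Implicit Types (mu nu : fdist R T) (f g : T -> R).

Lemma fdist_inj mu nu : fdval mu = fdval nu -> mu = nu.
Proof.
case: mu nu => [m mP] [n nP] /= e; case: n / e nP => nP.
by rewrite (bool_irrelevance mP nP).
Qed.

Lemma fdist_gt0 mu x : x \in fdval mu -> 0 < x.1.
Proof. by have /andP[/allP h _] := fdvalP mu => /h/andP[]. Qed.

Lemma fdist_sum1 mu : \sum_(x <- fdval mu) x.1 = 1.
Proof. by have /andP[_ /eqP] := fdvalP mu. Qed.

Definition expect mu f : R := \sum_(x <- fdval mu) x.1 * f x.2.

Lemma expect_cst mu c : expect mu (fun=> c) = c.
Proof. by rewrite /expect -mulr_suml fdist_sum1 mul1r. Qed.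

Lemma expectD mu f g : expect mu (fun t => f t + g t) = expect mu f + expect mu g.
Proof. by rewrite -big_split; apply: eq_bigr => x _; rewrite mulrDr. Qed.

Lemma expectZ mu c f : expect mu (fun t => c * f t) = c * expect mu f.
Proof. by rewrite mulr_sumr; apply: eq_bigr => x _; rewrite mulrCA. Qed.

Lemma le_expect mu f g : (forall t, supp mu t -> f t <= g t) ->
  expect mu f <= expect mu g.
Proof.
move=> fg; rewrite /expect [leLHS]big_seq [leRHS]big_seq.
apply: ler_sum => -[p t] pt.
rewrite ler_pM2l; last exact: fdist_gt0 pt.
by apply: fg; exists p.
Qed.

Lemma expect_fdirac t f : expect (fdirac t) f = f t.
Proof. by rewrite /expect (enum_msetn 1) big_seq1 mul1r. Qed.

Lemma expect_convex k (p : 'I_k -> R) (hp : weights p) (mu : 'I_k -> fdist R T) f :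
  expect (convex_comb hp mu) f = \sum_j p j * expect (mu j) f.
Proof.
rewrite /expect (perm_big _ (perm_eq_seq_mset _))/= big_flatten/= big_map big_enum/=.
by apply: eq_bigr => j _; rewrite big_map mulr_sumr; apply: eq_bigr => x _; rewrite mulrA.
Qed.

Lemma supp_fdirac (t u : T) : supp (fdirac t : fdist R T) u <-> u = t.
Proof.
split=> [[p]|->]; first by rewrite /= in_mset1 => /eqP[].
by exists 1; rewrite /= in_mset1.
Qed.

Lemma supp_convex k (p : 'I_k -> R) (hp : weights p) (mu : 'I_k -> fdist R T) t :
  supp (convex_comb hp mu) t <-> exists j, supp (mu j) t.
Proof.
split=> [[q]|[j [q qt]]].
  rewrite (perm_mem (perm_eq_seq_mset _)).
  move=> /flattenP[_ /mapP[j _ ->] /mapP[[q' u] uj [_ ->]]].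
  by exists j, q'.
exists (p j * q); rewrite (perm_mem (perm_eq_seq_mset _)).
apply/flattenP; exists [seq (p j * x.1, x.2) | x <- fdval (mu j)].
  by apply/mapP; exists j; rewrite ?mem_enum.
by apply/mapP; exists (q, t).
Qed.

Definition fdweight mu (j : 'I_(size (fdval mu))) : R :=
  (tnth (in_tuple (fdval mu)) j).1.

Definition fdpoint mu (j : 'I_(size (fdval mu))) : T :=
  (tnth (in_tuple (fdval mu)) j).2.

Lemma fdweightP mu : weights (@fdweight mu).
Proof.
apply/andP; split; last by rewrite -(big_tnth _ _ _ xpredT fst) fdist_sum1.
by apply/forallP => j; apply: (@fdist_gt0 mu); exact: mem_tnth.
Qed.

Lemma fdpointP mu t : supp mu t <-> exists j, @fdpoint mu j = t.
Proof.
split=> [[p pt]|[j <-]].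
  have /tnthP[j e] : (p, t) \in in_tuple (fdval mu) by [].
  by exists j; rewrite /fdpoint -e.
exists (fdweight j); rewrite -surjective_pairing.
exact: mem_tnth.
Qed.

(** This decomposition lets the convexity rule of the lifting act on an arbitrary distribution,
    entry by entry. *)
Lemma fdist_convex_fdirac mu :
  mu = convex_comb (fdweightP mu) (fun j => fdirac (fdpoint j)).
Proof.
apply: fdist_inj; rewrite /= /convex_mset -[LHS]seq_mset_id; congr seq_mset.
transitivity [seq tnth (in_tuple (fdval mu)) j | j <- enum 'I_(size (fdval mu))].
  exact: (esym (map_tnth_enum (in_tuple (fdval mu)))).
elim: (enum _) => //= j s ->; rewrite (enum_msetn 1) /= mulr1.
by rewrite /fdweight /fdpoint -surjective_pairing.
Qed.

(** The monadic bind: one round in which every entry evolves according to the strategy [k]. *)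
Definition fdbind mu (k : T -> fdist R T) : fdist R T :=
  convex_comb (fdweightP mu) (fun j => k (fdpoint j)).

Lemma expect_fdbind mu k f : expect (fdbind mu k) f = expect mu (fun t => expect (k t) f).
Proof.
rewrite expect_convex [RHS](big_tnth _ _ _ xpredT (fun x => x.1 * expect (k x.2) f)).
by [].
Qed.

Lemma supp_fdbind mu k u : supp (fdbind mu k) u <-> exists2 t, supp mu t & supp (k t) u.
Proof.
split=> [/supp_convex[j uj]|[t /fdpointP[j <-] uj]].
  by exists (fdpoint j) => //; apply/fdpointP; exists j.
by apply/supp_convex; exists j.
Qed.

Lemma lifting_fdbind step mu k :
  (forall t, supp mu t -> lifting step (fdirac t) (k t)) ->
  lifting step mu (fdbind mu k).
Proof.
move=> h; rewrite [mu in lifting _ mu]fdist_convex_fdirac.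
by apply: lifting_convex => j; apply: h; apply/fdpointP; exists j.
Qed.

Lemma lifting_uses_fdbind (L : Type) (step : L -> T -> fdist R T -> Prop) mu k U :
  (forall t, supp mu t -> lifting_uses step (U t) (fdirac t) (k t)) ->
  lifting_uses step (\bigcup_j U (@fdpoint mu j)) mu (fdbind mu k).
Proof.
move=> h; rewrite [X in lifting_uses _ _ X]fdist_convex_fdirac.
by apply: lifting_uses_convex => j; apply: h; apply/fdpointP; exists j.
Qed.

End Expectation.

Lemma exchange_expect (R : realType) (T U : choiceType) (mu : fdist R T)
    (nu : fdist R U) (f : T -> U -> R) :
  expect mu (fun t => expect nu (f t)) = expect nu (fun u => expect mu (f^~ u)).
Proof.
rewrite /expect; under eq_bigr do rewrite mulr_sumr.
rewrite exchange_big; apply: eq_bigr => u _; rewrite mulr_sumr.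
by apply: eq_bigr => t _; rewrite mulrCA.
Qed.

Lemma expect_fdmap (R : realType) (T U : choiceType) (h : T -> U) (mu : fdist R T) f :
  expect (fdmap h mu) f = expect mu (f \o h).
Proof. by rewrite /expect (perm_big _ (perm_eq_seq_mset _))/= big_map. Qed.

Lemma supp_fdmap (R : realType) (T U : choiceType) (h : T -> U) (mu : fdist R T) u :
  supp (fdmap h mu) u <-> exists2 t, supp mu t & h t = u.
Proof.
split=> [[p]|[t [p pt] <-]].
  rewrite (perm_mem (perm_eq_seq_mset _)) => /mapP[[q t] qt [_ ->]].
  by exists t => //; exists q.
by exists p; rewrite (perm_mem (perm_eq_seq_mset _)); apply/mapP; exists (p, t).
Qed.

(** * The optimal expected number of steps within a finite horizon *)

Section Value.
Context {R : realType} {T : choiceType}.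
Variable step : T -> fdist R T -> Prop.
Implicit Types (mu nu : fdist R T) (t : T) (n : nat).

(** The summand of [edl] becomes the expectation of an indicator, so linearity of expectation
    applies to it. *)
Lemma expected_steps mu :
  1 - nf_prob step mu = expect mu (fun t => (~~ `[< normal_form step t >])%:R).
Proof.
rewrite /nf_prob -[X in X - _](fdist_sum1 mu).
rewrite (bigID (fun x => `[< normal_form step x.2 >]))/= [LHS]addrC addKr.
rewrite big_mkcond; apply: eq_bigr => x _.
by case: ifP; rewrite (mulr1, mulr0).
Qed.

Lemma subr_nf_prob_ge0 mu : 0 <= 1 - nf_prob step mu.
Proof.
by rewrite expected_steps -(expect_cst mu 0) le_expect// => t _; rewrite ler0n.
Qed.

(** A Bellman recursion. The candidate [v = 0] keeps the set nonempty at normal forms, and the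
    horizon bounds it by [n], so [sup] is a genuine real supremum. *)
Fixpoint value n t : R :=
  if n is m.+1 then
    sup [set v | v = 0 \/ exists2 nu, step t nu & v = 1 + expect nu (value m)]
  else 0.

Lemma value_le n t c : 0 <= c ->
  (forall nu, step t nu -> 1 + expect nu (value n) <= c) -> value n.+1 t <= c.
Proof.
move=> c0 h; apply: ge_sup; first by exists 0; left.
by move=> v [->//|[nu st ->]]; exact: h.
Qed.

Lemma value_bounds n t : 0 <= value n t <= n%:R.
Proof.
elim: n t => [|n IH] t; first by rewrite /= lexx.
have ub nu : step t nu -> 1 + expect nu (value n) <= n.+1%:R.
  move=> _; rewrite -natr1 addrC lerD2r -[leRHS](expect_cst nu).
  by apply: le_expect => u _; have /andP[] := IH u.
rewrite value_le// andbT; apply: ub_le_sup; last by left.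
by exists n.+1%:R => v [->//|[nu st ->]]; exact: ub.
Qed.

Lemma value_ge0 n t : 0 <= value n t.
Proof. by have /andP[] := value_bounds n t. Qed.

Lemma value_step n t nu : step t nu -> 1 + expect nu (value n) <= value n.+1 t.
Proof.
move=> st; apply: ub_le_sup; last by right; exists nu.
exists n.+1%:R => v [->//|[nu' _ ->]].
rewrite -natr1 addrC lerD2r -[leRHS](expect_cst nu').
by apply: le_expect => u _; have /andP[] := value_bounds n u.
Qed.

Lemma value_nf n t : normal_form step t -> value n t = 0.
Proof.
case: n => // n nt; apply/le_anti; rewrite value_ge0 value_le// => nu st.
by case: nt; exists nu.
Qed.

Lemma value_nondecreasing n t : value n t <= value n.+1 t.
Proof.
elim: n t => [|n IH] t; first exact: value_ge0.
apply: value_le => [|nu st]; first exact: value_ge0.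
by apply: le_trans (value_step n.+1 st); rewrite lerD2l le_expect.
Qed.

(** Normal forms contribute 0, and every other term at most [n]. *)
Lemma expect_value_le mu n : expect mu (value n) <= n%:R * (1 - nf_prob step mu).
Proof.
rewrite expected_steps -expectZ; apply: le_expect => t _.
case: asboolP => [nt|_]; first by rewrite value_nf// mulr0.
by rewrite mulr1; have /andP[] := value_bounds n t.
Qed.

(** The Bellman inequality [value_step] averaged over one round: linearity of expectation carries it
    through convex combinations. *)
Lemma lifting_value n mu nu : lifting step mu nu ->
  1 - nf_prob step mu + expect nu (value n) <= expect mu (value n.+1).
Proof.
rewrite expected_steps; elim=> {mu nu} [t nt|t mu st|k p hp mu nu _ IH].
- by rewrite !expect_fdirac asboolT// !value_nf// addr0.
- rewrite !expect_fdirac asboolF; first exact: value_step.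
  by apply; exists mu.
- rewrite !expect_convex -big_split; apply: ler_sum => j _ /=.
  have /andP[/forallP/(_ j) pj _] := hp.
  by rewrite -mulrDr ler_pM2l.
Qed.

Lemma partial_edl_le n (mu : nat -> fdist R T) :
  (forall k, lifting step (mu k) (mu k.+1)) ->
  \sum_(0 <= k < n) (1 - nf_prob step (mu k)) <= expect (mu 0%N) (value n).
Proof.
elim: n mu => [|n IH] mu h; first by rewrite big_nil expect_cst.
rewrite big_nat_recl//; apply: le_trans (lifting_value n (h 0%N)).
by rewrite lerD2l; exact: (IH (fun k => mu k.+1)).
Qed.

End Value.

Lemma edl_le (R : realType) (T : choiceType) (step : T -> fdist R T -> Prop) mu c :
  (forall n, (\sum_(0 <= k < n) (1 - nf_prob step (mu k)))%:E <= c)%E ->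
  (edl step mu <= c)%E.
Proof.
move=> h; apply: lime_le.
  by apply: is_cvg_nneseries => n _ _; rewrite lee_fin subr_nf_prob_ge0.
by apply: nearW => n; rewrite sumEFin.
Qed.

(* If the series converges to [L] then [N * a K >= c - L] for every [K], which
   forces [c <= L] by summing over [K]. *)
Lemma le_nneseries_tail (R : realType) (a : nat -> R) (c : R) (N : nat) :
  (forall k, 0 <= a k) ->
  (forall K, c <= \sum_(0 <= k < K) a k + N%:R * a K) ->
  (c%:E <= \sum_(0 <= k <oo) (a k)%:E)%E.
Proof.
move=> a0 h; rewrite leNgt; apply/negP => lt.
have ge0 n : (0 <= n)%N -> true -> (0 <= (a n)%:E)%E by rewrite lee_fin.
have part K : ((\sum_(0 <= k < K) a k)%:E <= \sum_(0 <= k <oo) (a k)%:E)%E.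
  by rewrite -sumEFin; exact: (nneseries_lim_ge _ ge0).
move: lt part; case: (limn _) => [L||] //; last first.
  by move=> _ /(_ 0%N).
rewrite lte_fin => Lc part.
have {}part K : \sum_(0 <= k < K) a k <= L by rewrite -lee_fin.
have bound M : M%:R * (c - L) <= N%:R * L.
  apply: (@le_trans _ _ (\sum_(0 <= K < M) N%:R * a K)); last first.
    by rewrite -mulr_sumr ler_wpM2l.
  rewrite mulr_natl -[M in leLHS]subn0 -sumr_const_nat; apply: ler_sum => K _.
  by rewrite lerBlDl; apply: le_trans (h K) _; rewrite lerD2r.
have d0 : 0 < c - L by rewrite subr_gt0.
(* An Archimedean choice of [M] with [M * (c - L)] exceeding [N * L]. *)
have := bound (Num.bound (N%:R * L / (c - L))).
rewrite -ler_pdivlMr// leNgt => /negP; apply.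
have L0 : 0 <= L by have := part 0%N; rewrite big_nil.
by apply: archi_boundP; rewrite divr_ge0 ?mulr_ge0// ltW.
Qed.

(** * Reachable terms and the spareness of their steps *)

Section Reachable.
Context {R : realType} {F : countType} {ar : F -> nat}.
Local Notation term := (term ar).
Variable P : set (rule R F ar).
Implicit Types (t u : term) (mu nu : fdist R term).

Inductive reachable (t0 : term) : term -> Prop :=
| reachable_refl : reachable t0 t0
| reachable_step t nu u :
    reachable t0 t -> full_step P t nu -> supp nu u -> reachable t0 u.

(** A round of the lifting acts on all of [mu]: the step [l] is used at [t], an arbitrary step at
    every other reducible term, and normal forms stay put. *)
Lemma lifting_uses_extend mu t l nu : supp mu t -> step_by P l t nu ->
  exists2 nu', supp nu `<=` supp nu' &
    exists2 U : set (label), U l & lifting_uses (step_by P) U mu nu'.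
Proof.
move=> mut st.
have /choice[kU kUP] : forall s, exists kU : fdist R term * set label,
    lifting_uses (step_by P) kU.2 (fdirac s) kU.1 /\
    (s = t -> kU = (nu, [set l])).
  move=> s; have [->|sNt] := pselect (s = t).
    by exists (nu, [set l]); split=> //; exact: lifting_uses_step.
  have [ns|/contrapT[nu' [l' st']]] := pselect (normal_form (full_step P) s).
    by exists (fdirac s, set0); split=> //; exact: lifting_uses_nf.
  by exists (nu', [set l']); split=> //; exact: lifting_uses_step.
exists (fdbind mu (fun s => (kU s).1)).
  move=> u nuu; apply/supp_fdbind; exists t => //.
  by have [_ ->] := kUP t.
exists (\bigcup_j (kU (@fdpoint _ _ mu j)).2).
  have /fdpointP[j jt] := mut; exists j => //=.
  by have [_ ->] := kUP (fdpoint j).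
by apply: (lifting_uses_fdbind (U := fun s => (kU s).2)) => s _; have [] := kUP s.
Qed.

Definition lifting_sequence N (mu : nat -> fdist R term) (U : nat -> set label) :=
  forall n, (n < N)%N -> lifting_uses (step_by P) (U n) (mu n) (mu n.+1).

Lemma lifting_sequence_snoc N (mu : nat -> fdist R term) U V nu :
  lifting_sequence N mu U -> lifting_uses (step_by P) V (mu N) nu ->
  exists (mu' : nat -> fdist R term) U',
    [/\ lifting_sequence N.+1 mu' U', mu' 0%N = mu 0%N,
                     mu' N.+1 = nu & U' N = V].
Proof.
move=> muS lift; exists (fun n => if (n <= N)%N then mu n else nu).
exists (fun n => if (n < N)%N then U n else V); rewrite ltnn; split=> // n.
by rewrite ltnS; case: ltngtP => // [/muS|->].
Qed.

(** Each single step of the path is completed to a whole round and appended to the sequence. *)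
Lemma reachable_lifting t0 t : reachable t0 t ->
  exists N (mu : nat -> fdist R term) U,
    [/\ mu 0%N = fdirac t0, lifting_sequence N mu U & supp (mu N) t].
Proof.
elim=> [|{}t nu u _ [N [mu [U [mu0 muS muN]]]] [l st] nuu].
  by exists 0%N, (fun=> fdirac t0), (fun=> set0); split=> //; apply/supp_fdirac.
have [nu' sub [V Vl lift]] := lifting_uses_extend muN st.
have [mu' [U' [muS' mu0' muN' _]]] := lifting_sequence_snoc muS lift.
by exists N.+1, mu', U'; rewrite mu0' muN'; split=> //; exact: sub.
Qed.

(** One more round using [l], appended to a sequence that reaches [t], brings the step under the
    hypothesis [spare P]. *)
Lemma reachable_spare t0 t l nu : spare P -> basic P t0 -> reachable t0 t ->
  step_by P l t nu -> spare_label P l.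
Proof.
move=> sp bt0 /reachable_lifting[N [mu [U [mu0 muS muN]]]] st.
have [nu' sub [V Vl lift]] := lifting_uses_extend muN st.
have [mu' [U' [muS' mu0' _ UN]]] := lifting_sequence_snoc muS lift.
rewrite -mu0' in mu0.
by apply: (sp t0 N.+1 mu' U' bt0 mu0 muS' N (ltnSn N)); rewrite UN.
Qed.

End Reachable.

(** * Innermost strategies are at least as long as full rewriting *)

Section InnermostOptimal.
Context {R : realType} {F : countType} {ar : F -> nat}.
Local Notation term := (term ar).
Variable P : set (rule R F ar).
Hypotheses (ptrsP : is_ptrs P) (orthP : orthogonal_ptrs P) (spareP : spare P).
Variable t0 : term.
Hypothesis t0P : basic P t0.
Local Notation value := (value (full_step P)).

Lemma value_innermost n t p r sigma :
  reachable P t0 t -> P r -> subterm_at t p = Some (tsubst sigma r.1) ->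
  innermost_label P (p, r, sigma) ->
  value n t <= 1 + expect r.2 (fun v => value n (replace_at t p (tsubst sigma v))).
Proof.
elim: n t p => [|n IH] t p rt Pr st inn; first by rewrite expect_cst addr0.
have rhs0 n' s q : 0 <= expect r.2 (fun v => value n' (replace_at s q (tsubst sigma v))).
  by rewrite -[leLHS](expect_cst r.2) le_expect// => v _; exact: value_ge0.
apply: value_le => [|nu [[[p1 r1] sigma1] st1]]; first by rewrite addr_ge0.
have spare1 := reachable_spare spareP t0P rt st1.
have fst1 : full_step P t nu by exists (p1, r1, sigma1).
case: st1 => P1 st1 nuE; rewrite lerD2l.
(* If the first full step contracts the innermost redex itself, both sides have the same successors
   and only the horizon differs. *)
have [pp|/eqP pp] := eqVneq p1 p.
  subst p1; move: st1; rewrite st => -[e].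
  have [rr eu] := redex_unique ptrsP orthP Pr P1 e; subst r1.
  rewrite nuE expect_fdmap; apply: le_expect => u su /=.
  by rewrite -eu//; exact: value_nondecreasing.
have [sub [stsub diam]] := redex_commute orthP P1 Pr st1 spare1 st inn pp.
pose res u v := replace_at (replace_at t p (tsubst sigma v)) p1
                  (tsubst (sub (tsubst sigma v)) u).
(* After the [r1]-step the innermost redex survives at some [q], where the induction hypothesis
   applies, or it is erased and [res u v] equals [s] for every [v]. *)
have step1 u : supp r1.2 u ->
    value n (replace_at t p1 (tsubst sigma1 u)) <=
    1 + expect r.2 (fun v => value n (res u v)).
  move=> su; set s := replace_at t p1 _.
  case: (diam u su) => [[q sq resE]|resE].
    have rs : reachable P t0 s.
      apply: reachable_step rt fst1 _; rewrite nuE; apply/supp_fdmap.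
      by exists u.
    apply: le_trans (IH s q rs Pr sq inn) _; rewrite lerD2l.
    by apply: le_expect => v _; rewrite /res resE.
  rewrite -[leLHS]add0r lerD// -[leLHS](expect_cst r.2).
  by apply: le_expect => v _; rewrite /res resE.
rewrite nuE expect_fdmap; apply: le_trans (le_expect step1) _.
(* Exchanging the two expectations puts the innermost step first; the extra 1 then pays for the
   [r1]-step from each of its results, raising the horizon back to [n.+1]. *)
rewrite expectD expect_cst exchange_expect -(expect_cst r.2 1) -expectD.
apply: le_expect => v _; set s := replace_at t p _.
have sts : full_step P s
    (fdmap (fun u => replace_at s p1 (tsubst (sub (tsubst sigma v)) u)) r1.2).
  by exists (p1, r1, sub (tsubst sigma v)); split=> //; exact: stsub.
by apply: le_trans (value_step n sts); rewrite expect_fdmap.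
Qed.

(** Contract any innermost redex, and stay put at normal forms. The lifting holds at every term, but
    the bound on [value] relies on spareness and so is confined to reachable terms. *)
Lemma innermost_strategy : exists k : term -> fdist R term,
  (forall t, lifting (innermost_step P) (fdirac t) (k t)) /\
  (forall t, reachable P t0 t ->
    (forall u, supp (k t) u -> reachable P t0 u) /\
    (forall n, value n t <=
       (~~ `[< normal_form (full_step P) t >])%:R + expect (k t) (value n))).
Proof.
suff /choice[k kP] : forall t, exists kt : fdist R term,
    lifting (innermost_step P) (fdirac t) kt /\ (reachable P t0 t ->
    (forall u, supp kt u -> reachable P t0 u) /\
    (forall n, value n t <=
       (~~ `[< normal_form (full_step P) t >])%:R + expect kt (value n))).
  by exists k; split=> t; have [] := kP t.
move=> t; have [nt|nt] := pselect (normal_form (full_step P) t).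
  exists (fdirac t); split; first by apply: lifting_nf; rewrite normal_form_innermost.
  move=> rt; split=> [u /supp_fdirac ->//|n].
  by rewrite asboolT// add0r expect_fdirac.
have [p [r [sigma [Pr st inn]]]] := innermost_redex nt.
set kt := fdmap (fun u => replace_at t p (tsubst sigma u)) r.2.
have stk : step_by P (p, r, sigma) t kt by [].
exists kt; split; first by apply: lifting_step; exists (p, r, sigma).
move=> rt; split=> [u su|n]; last first.
  by rewrite asboolF// expect_fdmap; exact: value_innermost.
by apply: reachable_step rt _ su; exists (p, r, sigma).
Qed.

Lemma edh_full_le : (edh (full_step P) t0 <= edh (innermost_step P) t0)%E.
Proof.
have [k [klift kP]] := innermost_strategy.
pose mu n := iter n (fun m => fdbind m k) (fdirac t0).
have mu_reach n t : supp (mu n) t -> reachable P t0 t.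
  elim: n t => [|n IH] t; first by move=> /supp_fdirac ->; exact: reachable_refl.
  by move=> /supp_fdbind[s /IH /kP[+ _]]; apply.
pose a n := 1 - nf_prob (innermost_step P) (mu n).
(* The horizon [n] stays fixed while the strategy runs for [K] rounds. *)
have unroll n K : value n t0 <= \sum_(0 <= i < K) a i + expect (mu K) (value n).
  elim: K => [|K IH]; first by rewrite big_nil add0r expect_fdirac.
  apply: le_trans IH _; rewrite big_nat_recr//= -addrA lerD2l.
  rewrite /a expected_steps normal_form_innermost expect_fdbind -expectD.
  by apply: le_expect => t /mu_reach/kP[].
(* The remainder is at most [n * a K], so the horizon [n] is also the factor in the tail lemma. *)
have value_edl n : ((value n t0)%:E <= edl (innermost_step P) mu)%E.
  apply: (@le_nneseries_tail _ a _ n) => [i|K]; first exact: subr_nf_prob_ge0.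
  apply: le_trans (unroll n K) _; rewrite lerD2l.
  apply: le_trans (expect_value_le _ _ _) _.
  by rewrite /a /nf_prob normal_form_innermost.
apply: ge_ereal_sup => _ [nu [nu0 nuS] <-].
apply: (@le_trans _ _ (edl (innermost_step P) mu)); last first.
  apply: ereal_sup_ubound; exists mu => //; split=> // n.
  by apply: lifting_fdbind => t _; exact: klift.
apply: edl_le => n; apply: le_trans (value_edl n); rewrite lee_fin.
by apply: le_trans (partial_edl_le n nuS) _; rewrite nu0 expect_fdirac.
Qed.

End InnermostOptimal.

(** * The converse inequality and the conclusion *)

Lemma lifting_innermost_full (R : realType) (F : countType) (ar : F -> nat)
    (P : set (rule R F ar)) mu nu :
  lifting (innermost_step P) mu nu -> lifting (full_step P) mu nu.
Proof.
elim=> {mu nu} [t|t mu [l _ st]|k p hp mu nu _ IH].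
- by rewrite normal_form_innermost; exact: lifting_nf.
- by apply: lifting_step; exists l.
- exact: lifting_convex.
Qed.

(** An innermost sequence is also a full one, and its [edl] is unchanged because the normal forms
    agree. *)
Lemma edh_innermost_le (R : realType) (F : countType) (ar : F -> nat)
    (P : set (rule R F ar)) t :
  (edh (innermost_step P) t <= edh (full_step P) t)%E.
Proof.
apply: ge_ereal_sup => _ [mu [mu0 muS] <-]; apply: ereal_sup_ubound.
exists mu; first by split=> // n; exact: lifting_innermost_full.
by rewrite /edl /nf_prob normal_form_innermost.
Qed.

Theorem theorem5p16 (R : realType) (F : countType) (ar : F -> nat)
    (P : set (rule R F ar)) :
  is_ptrs P -> orthogonal_ptrs P -> spare P ->
  erc P (full_step P) = erc P (innermost_step P).
Proof.
move=> ptrsP orthP spareP; apply/funext => n; rewrite /erc; congr ereal_sup.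
(* Both suprema range over the same basic terms, so it suffices to compare [edh] at each of them. *)
apply/eq_imagel => t [bt _]; apply/le_anti.
by rewrite edh_full_le//= edh_innermost_le.
Qed.
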